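(* Suppose $b>1$, $\nu$ is a positive integer and $a>\nu-1$. Then for all $x\in(0,1)$ $$ m\,x^{2a}(1-x)^{2b}\le I_x(a,b)^2-I_x(a-\nu,b)\,I_x(a+\nu,b)\le M\,I_x(a,b)^2, $$ where $$ m=\frac{[\Gamma(a+b)]^2}{[\Gamma(b)]^2[\Gamma(a+1)]^2}-\frac{\Gamma(a+b-\nu)\,\Gamma(a+b+\nu)}{[\Gamma(b)]^2\,\Gamma(a-\nu+1)\,\Gamma(a+\nu+1)}, $$ $$ M=\frac{(a+1)_{\nu}(a+b-\nu)_{\nu}-(a+1-\nu)_{\nu}(a+b)_{\nu}}{(a+1)_{\nu}(a+b-\nu)_{\nu}}. $$
   Context: For $b>1$, $x\in(0,1)$ and $a>-1$, $I_x(a,b)$ denotes the normalized incomplete beta function $$I_x(a,b)=x^a(1-x)^b\sum_{n=0}^\infty\frac{\Gamma(a+b+n)}{\Gamma(b)\Gamma(a+1+n)}x^n,$$ which for $a>0$ equals $\dfrac{\int_0^x t^{a-1}(1-t)^{b-1}dt}{\int_0^1 t^{a-1}(1-t)^{b-1}dt}$. $(p)_0=1$ and $(p)_n=p(p+1)\cdots(p+n-1)$ is the Pochhammer symbol. *)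

(* Defs.v *)
From Stdlib Require Import Reals.
From Coquelicot Require Import Coquelicot.

Open Scope R_scope.

(* Euler's integral, as an improper integral at both endpoints. This is the
   Gamma function only for 0 < s, where the integral converges; for other s the
   value is unspecified. *)
Definition Gamma (s : R) : R :=
  RInt_gen (fun t : R => Rpower t (s - 1) * exp (- t))
    (at_right 0) (Rbar_locally p_infty).

(* (p)_n = p (p + 1) ... (p + n - 1) *)
Fixpoint pochhammer (p : R) (n : nat) : R :=
  match n with
  | O => 1
  | S k => pochhammer p k * (p + INR k)
  end.

(* I_x(a, b), meaningful for 0 < x < 1, -1 < a and 1 < b: every argument of
   Gamma below is then positive and the series converges. *)
Definition inc_beta (x a b : R) : R :=
  Rpower x a * Rpower (1 - x) b *
  Series (fun n : nat =>
    Gamma (a + b + INR n) / (Gamma b * Gamma (a + 1 + INR n)) * x ^ n).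

(* Main.v *)
(* Put c = a - nu and w k = Gamma (c + b + k) / (Gamma b * Gamma (c + 1 + k)).
   Then w (k + 1) / w k = rho k = (c + b + k) / (c + 1 + k), which is decreasing
   in k since b > 1, and I_x (c + j, b) = x^(c + j) (1 - x)^b S j with
   S j = sum_n w (j + n) x^n.  The claim becomes
     w nu ^2 - w 0 * w (2 nu) <= S nu ^2 - S 0 * S (2 nu)
                              <= (1 - w 0 * w (2 nu) / w nu ^2) * S nu ^2.
   Lower bound: because S k = w k + x * S (k + 1), for p <= q the difference
   S (p+1) * S q - S p * S (q+1) equals w q * S (p+1) - w p * S (q+1), a power
   series with nonnegative coefficients by log-concavity of w, so it is at least
   its constant term; these bounds telescope from the inside out.
   Upper bound: rho (p + n) ^2 <= rho n * rho (2 p + n) makes w (p + n) / w p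
   log-convex in p, and Cauchy-Schwarz passes this to S p / w p. *)

Require Import Defs.
From Stdlib Require Import Reals Lra Lia.
From Coquelicot Require Import Coquelicot.

Open Scope R_scope.

(** * Monotone limits and improper integrals over the half line *)

Lemma exp_le_compat (x y : R) : x <= y -> exp x <= exp y.
Proof.
  intros [Hlt | ->]; [left; now apply exp_increasing | right; reflexivity].
Qed.

(** The limit is the supremum of the values beyond [A]. The bound [F u <= l] is kept because
    positivity of Gamma needs it, not only convergence. *)
Lemma monotone_bounded_cvg_p_infty (F : R -> R) (A B : R) :
  (forall u v, A <= u <= v -> F u <= F v) ->
  (forall u, A <= u -> F u <= B) ->
  exists l : R, filterlim F (Rbar_locally p_infty) (locally l) /\
    forall u, A <= u -> F u <= l.
Proof.
  intros Hmono Hbound.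
  destruct (completeness (fun y => exists u, A <= u /\ y = F u)) as [l [Hub Hleast]].
  - exists B. intros y [u [Hu ->]]. now apply Hbound.
  - exists (F A), A. split; [lra | reflexivity].
  - assert (Hle : forall u, A <= u -> F u <= l).
    { intros u Hu. apply Hub. now exists u. }
    exists l. split; [| exact Hle].
    apply filterlim_locally. intros eps.
    (* If no value exceeded [l - eps], that number would be an upper bound below the supremum. *)
    destruct (Classical_Prop.classic (exists u, A <= u /\ l - eps < F u))
      as [[u [Hu Hlu]] | Hno].
    + exists u. intros v Hv.
      assert (F u <= F v) by (apply Hmono; lra).
      assert (F v <= l) by (apply Hle; lra).
      apply Rabs_def1; unfold minus, plus, opp; simpl; pose proof (cond_pos eps); lra.
    + exfalso.
      assert (l <= l - eps).
      { apply Hleast. intros y [u [Hu ->]].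
        apply Rnot_lt_le. intros Hlt. apply Hno. now exists u. }
      pose proof (cond_pos eps). lra.
Qed.

(** The substitution [u -> - F (/ u)] carries the right neighbourhood of 0 to infinity and keeps the
    function nondecreasing, so the previous lemma applies. *)
Lemma monotone_bounded_cvg_at_right_0 (F : R -> R) (B : R) :
  (forall u v, 0 < u <= v -> v <= 1 -> F u <= F v) ->
  (forall u, 0 < u <= 1 -> B <= F u) ->
  exists l : R, filterlim F (at_right 0) (locally l) /\
    forall u, 0 < u <= 1 -> l <= F u.
Proof.
  intros Hmono Hbound.
  assert (Hinv : forall u, 1 <= u -> 0 < / u <= 1).
  { intros u Hu. split; [apply Rinv_0_lt_compat; lra |].
    rewrite <- Rinv_1. apply Rinv_le_contravar; lra. }
  destruct (monotone_bounded_cvg_p_infty (fun u => - F (/ u)) 1 (- B))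
    as [l [Hlim Hle]].
  - intros u v Huv. apply Ropp_le_contravar, Hmono.
    + split; [apply Hinv; lra | apply Rinv_le_contravar; lra].
    + apply Hinv; lra.
  - intros u Hu. apply Ropp_le_contravar, Hbound, Hinv, Hu.
  - exists (- l). split.
    + apply filterlim_ext with (fun u => opp (- F (/ / u))).
      { intros u. rewrite Rinv_inv. unfold opp; simpl. apply Ropp_involutive. }
      apply filterlim_comp with (locally l).
      * apply (filterlim_comp _ _ _ Rinv (fun u => - F (/ u)) _ (Rbar_locally p_infty)).
        -- exact filterlim_Rinv_0_right.
        -- exact Hlim.
      * exact (filterlim_opp l).
    + intros u Hu. assert (1 <= / u).
      { rewrite <- Rinv_1. apply Rinv_le_contravar; lra. }
      specialize (Hle (/ u) H). rewrite Rinv_inv in Hle. lra.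
Qed.

(** The fundamental theorem of calculus on each compact interval between positive endpoints,
    followed by a limit at each end. *)
Lemma is_RInt_gen_half_line (F f : R -> R) (la lb : R) :
  (forall t, 0 < t -> is_derive F t (f t)) ->
  (forall t, 0 < t -> continuous f t) ->
  filterlim F (at_right 0) (locally la) ->
  filterlim F (Rbar_locally p_infty) (locally lb) ->
  is_RInt_gen f (at_right 0) (Rbar_locally p_infty) (lb - la).
Proof.
  intros HF Hf Ha Hb.
  apply (filterlimi_lim_ext_loc (fun ab : R * R => F (snd ab) - F (fst ab))).
  - exists (fun u => 0 < u) (fun v => 0 < v).
    + exists (mkposreal 1 Rlt_0_1). now intros.
    + now exists 0.
    + intros u v Hu Hv. simpl.
      apply (is_RInt_derive F f); intros t Ht; [apply HF | apply Hf];
        (apply Rlt_le_trans with (Rmin u v); [now apply Rmin_pos | apply Ht]).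
  - apply (filterlim_comp_2 (G := locally lb) (H := locally (opp la))
      (fun ab : R * R => F (snd ab)) (fun ab : R * R => opp (F (fst ab))) plus).
    + apply (filterlim_comp _ _ _ snd F _ (Rbar_locally p_infty));
        [apply filterlim_snd | exact Hb].
    + apply filterlim_comp with (locally la).
      * apply (filterlim_comp _ _ _ fst F _ (at_right 0));
          [apply filterlim_fst | exact Ha].
      * exact (filterlim_opp la).
    + exact (filterlim_plus lb (opp la)).
Qed.

(** * Euler's integral: convergence, positivity and functional equation *)

Lemma is_derive_Rpower (p t : R) :
  0 < t -> is_derive (fun u => Rpower u p) t (p * Rpower t (p - 1)).
Proof. intros Ht. apply is_derive_Reals. now apply derivable_pt_lim_power. Qed.

Lemma derive_nonneg_incr (g dg : R -> R) (A u v : R) :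
  (forall t, A < t -> is_derive g t (dg t)) ->
  (forall t, A < t -> 0 <= dg t) ->
  A < u -> u <= v -> g u <= g v.
Proof.
  intros Hg Hdg Hu Huv.
  destruct (MVT_gen g u v dg) as [c [[Hc _] Heq]].
  - intros t [Ht _]. rewrite Rmin_left in Ht by lra. apply Hg. lra.
  - intros t [Ht _]. rewrite Rmin_left in Ht by lra.
    apply continuity_pt_filterlim, (ex_derive_continuous (V := R_NormedModule)).
    exists (dg t). apply Hg. lra.
  - rewrite Rmin_left in Hc by lra.
    assert (0 <= dg c) by (apply Hdg; lra). nra.
Qed.

Lemma is_derive_exp_scal (c t : R) :
  is_derive (fun u => exp (c * u)) t (c * exp (c * t)).
Proof. auto_derive; [trivial | ring]. Qed.

Lemma continuous_Gamma_integrand (s t : R) :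
  0 < t -> continuous (fun u => Rpower u (s - 1) * exp (- u)) t.
Proof.
  intros Ht. apply (ex_derive_continuous (V := R_NormedModule)).
  auto_derive.
  exists ((s - 1) * Rpower t (s - 1 - 1)). now apply is_derive_Rpower.
Qed.

(** Apply [1 + ln y <= y] with [y = t / (2 * q)]: then [q * ln t <= t / 2 + q * ln (2 * q)], and the
    last term becomes the constant. *)
Lemma Rpower_le_exp_half (p : R) :
  exists C, 0 < C /\ forall t, 1 < t -> Rpower t p <= C * exp (t / 2).
Proof.
  (* A positive majorant of [p], so that dividing by [q] is safe for every sign of [p]. *)
  set (q := Rabs p + 1).
  assert (Hq : 0 < q) by (unfold q; pose proof (Rabs_pos p); lra).
  assert (Hpq : p <= q) by (unfold q; pose proof (Rle_abs p); lra).
  exists (exp (q * ln (2 * q))). split; [apply exp_pos |].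
  intros t Ht. rewrite <- exp_plus. unfold Rpower. apply exp_le_compat.
  assert (Hln : ln t <= t / (2 * q) + ln (2 * q)).
  { assert (0 < t / (2 * q)) by (apply Rdiv_lt_0_compat; lra).
    replace t with (t / (2 * q) * (2 * q)) at 1 by (field; lra).
    rewrite ln_mult by lra.
    pose proof (exp_ineq1_le (ln (t / (2 * q)))) as H1.
    rewrite exp_ln in H1 by lra. lra. }
  assert (0 < ln t) by (rewrite <- ln_1; apply ln_increasing; lra).
  apply Rle_trans with (q * ln t); [apply Rmult_le_compat_r; lra |].
  apply Rle_trans with (q * (t / (2 * q) + ln (2 * q))).
  - apply Rmult_le_compat_l; lra.
  - right. field. lra.
Qed.

Lemma filterlim_exp_neg_half :
  filterlim (fun t => exp (- (1 / 2) * t)) (Rbar_locally p_infty) (locally 0).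
Proof.
  apply (filterlim_comp _ _ _ (fun t => - (1 / 2) * t) exp _ (Rbar_locally m_infty)).
  - intros P [M HM]. exists (- 2 * M). intros t Ht. apply HM. lra.
  - exact is_lim_exp_m.
Qed.

(** Squeezed between 0 and [C * exp (- t / 2)]. *)
Lemma filterlim_Rpower_exp_p_infty (s : R) :
  filterlim (fun t => Rpower t s * exp (- t)) (Rbar_locally p_infty) (locally 0).
Proof.
  destruct (Rpower_le_exp_half s) as [C [HC Hle]].
  apply (filterlim_le_le (F := Rbar_locally p_infty) (fun _ => 0) _
    (fun t => scal C (exp (- (1 / 2) * t))) 0).
  - exists 1. intros t Ht. split.
    + apply Rmult_le_pos; left; apply exp_pos.
    + apply Rle_trans with (C * exp (t / 2) * exp (- t)).
      * apply Rmult_le_compat_r; [left; apply exp_pos | now apply Hle].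
      * right. unfold scal; simpl; unfold mult; simpl.
        rewrite Rmult_assoc, <- exp_plus. do 2 f_equal. field.
  - apply filterlim_const.
  - replace (Finite 0) with (Finite (scal C 0)) by (f_equal; apply Rmult_0_r).
    apply filterlim_comp with (locally 0); [exact filterlim_exp_neg_half |].
    exact (filterlim_scal_r C 0).
Qed.

Lemma filterlim_Rpower_at_right_0 (s : R) :
  0 < s -> filterlim (fun t => Rpower t s) (at_right 0) (locally 0).
Proof.
  intros Hs.
  apply (filterlim_comp _ _ _ (fun t => s * ln t) exp _ (Rbar_locally m_infty));
    [| exact is_lim_exp_m].
  apply (filterlim_comp _ _ _ ln (fun y => s * y) _ (Rbar_locally m_infty)).
  - exact is_lim_ln_0.
  - intros P [M HM]. exists (M / s). intros y Hy. apply HM.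
    replace M with (s * (M / s)) by (field; lra). now apply Rmult_lt_compat_l.
Qed.

Lemma filterlim_Rpower_exp_at_right_0 (s : R) :
  0 < s -> filterlim (fun t => Rpower t s * exp (- t)) (at_right 0) (locally 0).
Proof.
  intros Hs.
  apply (filterlim_le_le (F := at_right 0) (fun _ => 0) _ (fun t => Rpower t s) 0).
  - exists (mkposreal 1 Rlt_0_1). intros t _ Ht.
    assert (0 < Rpower t s) by apply exp_pos.
    assert (exp (- t) <= 1) by (rewrite <- exp_0; apply exp_le_compat; lra).
    pose proof (exp_pos (- t)). split; nra.
  - apply filterlim_const.
  - now apply filterlim_Rpower_at_right_0.
Qed.

(** The primitive [F] based at 1 is increasing, so it suffices to bound it above near infinity and
    below near 0. The integral is the difference of the two limits, and is positive because
    [F 1 < F 2] lies between them. *)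
Lemma Gamma_integral_exists_pos (s : R) :
  0 < s ->
  exists l : R, 0 < l /\
    is_RInt_gen (fun t => Rpower t (s - 1) * exp (- t))
      (at_right 0) (Rbar_locally p_infty) l.
Proof.
  intros Hs.
  set (f := fun t => Rpower t (s - 1) * exp (- t)).
  set (F := fun u => RInt f 1 u).
  assert (Hfc : forall t, 0 < t -> continuous f t)
    by (intros; now apply continuous_Gamma_integrand).
  assert (Hfpos : forall t, 0 < f t)
    by (intros; apply Rmult_lt_0_compat; apply exp_pos).
  assert (HF : forall t, 0 < t -> is_derive F t (f t)).
  { intros t Ht. apply (is_derive_RInt f F 1); [| now apply Hfc].
    exists (mkposreal t Ht). intros u Hu.
    apply (RInt_correct f 1 u), (ex_RInt_continuous f). intros z [Hz _]. apply Hfc.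
    apply Rlt_le_trans with (2 := Hz). apply Rmin_pos; [lra |].
    apply Rabs_def2 in Hu. unfold minus, plus, opp in Hu; simpl in Hu. lra. }
  assert (Hmono : forall u v, 0 < u <= v -> F u <= F v).
  { intros u v [Hu Huv].
    apply (derive_nonneg_incr F f 0); trivial.
    intros t _. left. apply Hfpos. }
  destruct (Rpower_le_exp_half (s - 1)) as [C [HC Hle]].
  destruct (monotone_bounded_cvg_p_infty F 2
              (F 2 + 2 * C * exp (- (1 / 2) * 2))) as [lb [Hlb Hlb']].
  - intros u v Huv. apply Hmono. lra.
  - intros u Hu.
    (* [- 2 * C * exp (- t / 2)] is a primitive of the majorant [C * exp (- t / 2)] of [f], so its
       difference with [F] is nondecreasing beyond 1. *)
    assert (H : - 2 * C * exp (- (1 / 2) * 2) - F 2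
                <= - 2 * C * exp (- (1 / 2) * u) - F u).
    { apply (derive_nonneg_incr (fun t => - 2 * C * exp (- (1 / 2) * t) - F t)
        (fun t => C * exp (- (1 / 2) * t) - f t) 1); try lra.
      - intros t Ht. apply (is_derive_minus (fun t => - 2 * C * exp (- (1 / 2) * t)) F).
        + replace (C * exp (- (1 / 2) * t))
            with (- 2 * C * (- (1 / 2) * exp (- (1 / 2) * t))) by field.
          apply is_derive_scal, is_derive_exp_scal.
        + apply HF. lra.
      - intros t Ht. unfold f.
        assert (Rpower t (s - 1) * exp (- t) <= C * exp (t / 2) * exp (- t))
          by (apply Rmult_le_compat_r; [left; apply exp_pos | now apply Hle]).
        rewrite Rmult_assoc, <- exp_plus in H.
        replace (t / 2 + - t) with (- (1 / 2) * t) in H by field. lra. }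
    assert (0 < C * exp (- (1 / 2) * u)) by (apply Rmult_lt_0_compat; [lra | apply exp_pos]).
    lra.
  - destruct (monotone_bounded_cvg_at_right_0 F (F 1 - / s)) as [la [Hla Hla']].
    + intros u v Huv _. now apply Hmono.
    + intros u Hu.
      (* Near 0 the majorant is [Rpower t (s - 1)], with primitive [Rpower t s / s]; dropping its
         positive value at [u] gives the bound [F 1 - / s]. *)
      assert (H : / s * Rpower u s - F u <= / s * Rpower 1 s - F 1).
      { apply (derive_nonneg_incr (fun t => / s * Rpower t s - F t)
          (fun t => Rpower t (s - 1) - f t) 0); try lra.
        - intros t Ht. apply (is_derive_minus (fun t => / s * Rpower t s) F).
          + replace (Rpower t (s - 1)) with (/ s * (s * Rpower t (s - 1))) by (field; lra).
            now apply is_derive_scal, is_derive_Rpower.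
          + now apply HF.
        - intros t Ht. unfold f.
          assert (0 < Rpower t (s - 1)) by apply exp_pos.
          assert (exp (- t) <= 1) by (rewrite <- exp_0; apply exp_le_compat; lra).
          nra. }
      assert (0 < / s * Rpower u s)
        by (apply Rmult_lt_0_compat; [now apply Rinv_0_lt_compat | apply exp_pos]).
      unfold Rpower at 2 in H. rewrite ln_1, Rmult_0_r, exp_0 in H. lra.
    + exists (lb - la). split.
      * assert (F 1 < F 2).
        { apply (incr_function F 0 p_infty f); simpl; trivial; try lra.
          - intros t Ht _. now apply HF.
          - intros t _ _. apply Hfpos. }
        assert (F 2 <= lb) by (apply Hlb'; lra).
        assert (la <= F 1) by (apply Hla'; lra).
        lra.
      * now apply is_RInt_gen_half_line with F.
Qed.

(** [Gamma] is total by way of [RInt_gen]; this certifies that for positive [s] its value is a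
    genuine convergent integral. *)
Lemma is_RInt_gen_Gamma (s : R) :
  0 < s ->
  is_RInt_gen (fun t => Rpower t (s - 1) * exp (- t))
    (at_right 0) (Rbar_locally p_infty) (Gamma s).
Proof.
  intros Hs. destruct (Gamma_integral_exists_pos s Hs) as [l [_ Hl]].
  unfold Gamma. now rewrite (is_RInt_gen_unique _ _ Hl).
Qed.

Lemma Gamma_pos (s : R) : 0 < s -> 0 < Gamma s.
Proof.
  intros Hs. destruct (Gamma_integral_exists_pos s Hs) as [l [Hpos Hl]].
  unfold Gamma. now rewrite (is_RInt_gen_unique _ _ Hl).
Qed.

(** Integration by parts: the difference of the two integrands is the derivative of
    [Rpower t s * exp (- t)], which tends to 0 at both ends. Uniqueness of the integral then equates
    [s * Gamma s - Gamma (s + 1)] with 0. *)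
Lemma Gamma_succ (s : R) : 0 < s -> Gamma (s + 1) = s * Gamma s.
Proof.
  intros Hs.
  assert (Hs1 : 0 < s + 1) by lra.
  pose proof (is_RInt_gen_Gamma s Hs) as H0.
  pose proof (is_RInt_gen_Gamma (s + 1) Hs1) as H1.
  pose proof (is_RInt_gen_minus _ _ _ _ (is_RInt_gen_scal _ s _ H0) H1) as H2.
  assert (H3 : is_RInt_gen (fun t => minus (scal s (Rpower t (s - 1) * exp (- t)))
                 (Rpower t (s + 1 - 1) * exp (- t)))
               (at_right 0) (Rbar_locally p_infty) (0 - 0)).
  { apply is_RInt_gen_half_line with (fun t => Rpower t s * exp (- t)).
    - intros t Ht. unfold minus, plus, opp, scal; simpl; unfold mult; simpl.
      replace (s + 1 - 1) with s by ring.
      replace (s * (Rpower t (s - 1) * exp (- t)) + - (Rpower t s * exp (- t)))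
        with (s * Rpower t (s - 1) * exp (- t) + Rpower t s * (- exp (- t))) by ring.
      apply (is_derive_mult (fun t => Rpower t s) (fun t => exp (- t))).
      + now apply is_derive_Rpower.
      + auto_derive; [trivial | ring].
      + intros; apply Rmult_comm.
    - intros t Ht.
      apply (continuous_minus (V := R_NormedModule)
        (fun t => scal s (Rpower t (s - 1) * exp (- t)))).
      + apply (continuous_scal_r (V := R_NormedModule)). now apply continuous_Gamma_integrand.
      + now apply continuous_Gamma_integrand.
    - now apply filterlim_Rpower_exp_at_right_0.
    - apply filterlim_Rpower_exp_p_infty. }
  pose proof (is_RInt_gen_unique (V := R_CompleteNormedModule) _ _ H2) as E2.
  pose proof (is_RInt_gen_unique (V := R_CompleteNormedModule) _ _ H3) as E3.
  pose proof (eq_trans (eq_sym E2) E3) as E.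
  unfold minus, plus, opp, scal in E; simpl in E; unfold mult in E; simpl in E.
  lra.
Qed.

(** * Inequalities for series of nonnegative terms *)

Lemma Series_ge_head (u : nat -> R) :
  (forall n, 0 <= u n) -> ex_series u -> u O <= Series u.
Proof.
  intros Hu Hex. rewrite (Series_incr_1 u Hex).
  assert (0 <= Series (fun n => u (S n))); [| lra].
  rewrite <- (Rmult_0_l (Series (fun n => u (S n)))), <- Series_scal_l.
  apply Series_le; [intros n; specialize (Hu (S n)); lra |].
  now apply (ex_series_incr_1 u).
Qed.

Lemma Series_Cauchy_Schwarz (p q r : nat -> R) :
  (forall n, 0 < p n) -> (forall n, 0 < q n) -> (forall n, 0 < r n) ->
  (forall n, r n ^ 2 <= p n * q n) ->
  ex_series p -> ex_series q -> ex_series r ->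
  Series r ^ 2 <= Series p * Series q.
Proof.
  intros Hp Hq Hr Hpqr Ep Eq Er.
  assert (HP : 0 < Series p).
  { apply Rlt_le_trans with (p O); [apply Hp |].
    apply Series_ge_head; [intros n; left; apply Hp | exact Ep]. }
  assert (HR : 0 < Series r).
  { apply Rlt_le_trans with (r O); [apply Hr |].
    apply Series_ge_head; [intros n; left; apply Hr | exact Er]. }
  set (P := Series p) in *. set (T := Series r) in *.
  (* AM-GM with the optimal weight [T / P], cleared of denominators *)
  assert (Hn : forall n, 2 * P * T * r n <= T ^ 2 * p n + P ^ 2 * q n).
  { intros n. specialize (Hp n). specialize (Hq n). specialize (Hr n). specialize (Hpqr n).
    assert (0 < T ^ 2 * p n) by (apply Rmult_lt_0_compat; [apply pow_lt |]; assumption).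
    assert (0 < P ^ 2 * q n) by (apply Rmult_lt_0_compat; [apply pow_lt |]; assumption).
    (* After squaring, the gap between the sides is at least the square of
       [T ^ 2 * p n - P ^ 2 * q n], since [r n ^ 2 <= p n * q n]. *)
    apply Rsqr_incr_0_var; [| lra]. unfold Rsqr.
    assert ((P * T) ^ 2 * r n ^ 2 <= (P * T) ^ 2 * (p n * q n))
      by (apply Rmult_le_compat_l; [apply pow2_ge_0 | assumption]).
    pose proof (pow2_ge_0 (T ^ 2 * p n - P ^ 2 * q n)). nra. }
  (* Summing over [n] turns [r n] into [T] and [p n] into [P]; cancelling [P] twice leaves
     [T ^ 2 <= P * Series q]. *)
  assert (H : 2 * P * T * T <= T ^ 2 * P + P ^ 2 * Series q).
  { unfold T at 2, P at 2. rewrite <- !Series_scal_l.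
    rewrite <- Series_plus
      by (apply (ex_series_scal_l (V := R_NormedModule)); assumption).
    apply Series_le.
    - intros n. split; [| apply Hn].
      left. repeat apply Rmult_lt_0_compat; try assumption; [lra | apply Hr].
    - apply (ex_series_plus (V := R_NormedModule));
        apply (ex_series_scal_l (V := R_NormedModule)); assumption. }
  apply Rmult_le_reg_l with P; [exact HP |]. nra.
Qed.

(** * Turán-type bounds for tails of a power series with decreasing coefficient ratios *)

Section RatioSequence.

Variables (w rho : nat -> R) (x : R).
Hypothesis w_pos : forall k, 0 < w k.
Hypothesis w_succ : forall k, w (S k) = rho k * w k.
Hypothesis rho_antitone : forall i j, (i <= j)%nat -> rho j <= rho i.
Hypothesis x_pos : 0 < x.
Hypothesis tail_cvg : forall k, ex_series (fun n => w (k + n)%nat * x ^ n).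

(** Multiplied by [x ^ k], this is the tail of the full series from index [k] on. *)
Definition tail_gf (k : nat) : R := Series (fun n => w (k + n)%nat * x ^ n).

Let rho_pos (k : nat) : 0 < rho k.
Proof.
  apply Rmult_lt_reg_r with (w k); [apply w_pos |].
  rewrite Rmult_0_l, <- w_succ. apply w_pos.
Qed.

(** [w (j + n) / w j] is a product of [n] consecutive ratios starting at [rho j], each at most the
    matching factor of [w (i + n) / w i]. *)
Lemma log_concave_exchange (i j n : nat) :
  (i <= j)%nat -> w i * w (j + n)%nat <= w (i + n)%nat * w j.
Proof.
  intros Hij. induction n as [| n IH].
  - rewrite !Nat.add_0_r. lra.
  - rewrite !Nat.add_succ_r, !w_succ.
    assert (rho (j + n)%nat <= rho (i + n)%nat) by (apply rho_antitone; lia).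
    apply Rle_trans with (rho (j + n)%nat * (w (i + n)%nat * w j)).
    + pose proof (rho_pos (j + n)%nat). nra.
    + pose proof (w_pos (i + n)%nat). pose proof (w_pos j).
      assert (0 < w (i + n)%nat * w j) by now apply Rmult_lt_0_compat.
      nra.
Qed.

Lemma tail_gf_succ (k : nat) : tail_gf k = w k + x * tail_gf (S k).
Proof.
  unfold tail_gf. rewrite (Series_incr_1 _ (tail_cvg k)).
  rewrite Nat.add_0_r. simpl (x ^ 0). rewrite Rmult_1_r. f_equal.
  rewrite <- Series_scal_l. apply Series_ext. intros n.
  rewrite Nat.add_succ_r. simpl. ring.
Qed.

(* Substituting [tail_gf_succ] for [tail_gf p] and [tail_gf q] cancels the
   products of two series: the left-hand side is
   [w q * tail_gf (S p) - w p * tail_gf (S q)], which is nonnegative termwise. *)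
Lemma tail_gf_exchange (p q : nat) :
  (p <= q)%nat ->
  w (S p) * w q - w p * w (S q)
    <= tail_gf (S p) * tail_gf q - tail_gf p * tail_gf (S q).
Proof.
  intros Hpq. rewrite (tail_gf_succ p), (tail_gf_succ q).
  replace (tail_gf (S p) * (w q + x * tail_gf (S q))
           - (w p + x * tail_gf (S p)) * tail_gf (S q))
    with (w q * tail_gf (S p) - w p * tail_gf (S q)) by ring.
  unfold tail_gf. rewrite <- !Series_scal_l.
  rewrite <- Series_minus
    by (apply (ex_series_scal_l (V := R_NormedModule)); apply tail_cvg).
  set (u := fun n => w q * (w (S p + n)%nat * x ^ n) - w p * (w (S q + n)%nat * x ^ n)).
  replace (w (S p) * w q - w p * w (S q)) with (u O)
    by (unfold u; rewrite !Nat.add_0_r; simpl; ring).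
  apply Series_ge_head.
  - intros n. unfold u. pose proof (log_concave_exchange p q (S n) Hpq) as H.
    rewrite !Nat.add_succ_r in H. simpl.
    pose proof (pow_lt x n x_pos). nra.
  - apply (ex_series_minus (V := R_NormedModule));
      apply (ex_series_scal_l (V := R_NormedModule)); apply tail_cvg.
Qed.

(** Passing from [(S p, d)] to [(p, S d)] keeps the centre fixed and moves the outer indices apart
    by one on each side; the change is exactly the exchange inequality for [p] and [S p + 2 * d]. *)
Lemma tail_gf_lower (d p : nat) :
  w (p + d)%nat ^ 2 - w p * w (p + 2 * d)%nat
    <= tail_gf (p + d) ^ 2 - tail_gf p * tail_gf (p + 2 * d).
Proof.
  revert p. induction d as [| d IH]; intros p.
  - rewrite Nat.mul_0_r, !Nat.add_0_r. lra.
  - specialize (IH (S p)).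
    pose proof (tail_gf_exchange p (S p + 2 * d) ltac:(lia)) as H.
    replace (p + S d)%nat with (S p + d)%nat by lia.
    replace (p + 2 * S d)%nat with (S (S p + 2 * d))%nat by lia.
    lra.
Qed.

(** The ratio hypothesis propagates by induction to a bound on each coefficient, and Cauchy-Schwarz
    sums these bounds. Denominators are cleared throughout. *)
Lemma tail_gf_upper (p : nat) :
  (forall n, rho (p + n)%nat ^ 2 <= rho n * rho (2 * p + n)%nat) ->
  w O * w (2 * p)%nat * tail_gf p ^ 2
    <= w p ^ 2 * (tail_gf O * tail_gf (2 * p)).
Proof.
  intros Hrho.
  assert (Hw : forall n, w O * w (2 * p)%nat * w (p + n)%nat ^ 2
                 <= w p ^ 2 * (w n * w (2 * p + n)%nat)).
  { induction n as [| n IH].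
    - rewrite !Nat.add_0_r. lra.
    - rewrite !Nat.add_succ_r, !w_succ. specialize (Hrho n).
      assert (0 <= w O * w (2 * p)%nat * w (p + n)%nat ^ 2).
      { pose proof (pow2_ge_0 (w (p + n)%nat)).
        apply Rmult_le_pos; [apply Rmult_le_pos; left; apply w_pos | assumption]. }
      apply Rle_trans with (rho (p + n)%nat ^ 2
        * (w O * w (2 * p)%nat * w (p + n)%nat ^ 2)); [right; ring |].
      apply Rle_trans with ((rho n * rho (2 * p + n)%nat)
        * (w p ^ 2 * (w n * w (2 * p + n)%nat))); [| right; ring].
      apply Rmult_le_compat; trivial. apply pow2_ge_0. }
  set (c := w O * w (2 * p)%nat).
  assert (Hc : 0 < c) by (apply Rmult_lt_0_compat; apply w_pos).
  assert (Hwp : 0 < w p ^ 2) by (apply pow_lt, w_pos).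
  assert (Hx : forall n, 0 < x ^ n) by (intros n; now apply pow_lt).
  (* Scaling both the squared series and one factor by [c] avoids the square root of [c]; the
     surplus [c] is cancelled at the end. *)
  assert (H : Series (fun n => c * (w (p + n)%nat * x ^ n)) ^ 2
    <= Series (fun n => (c * w p ^ 2) * (w (0 + n)%nat * x ^ n))
       * Series (fun n => w (2 * p + n)%nat * x ^ n)).
  { apply Series_Cauchy_Schwarz.
    - intros n. apply Rmult_lt_0_compat; [now apply Rmult_lt_0_compat |].
      now apply Rmult_lt_0_compat.
    - intros n. now apply Rmult_lt_0_compat.
    - intros n. apply Rmult_lt_0_compat; [exact Hc |].
      now apply Rmult_lt_0_compat.
    - intros n. specialize (Hw n). fold c in Hw. simpl (0 + n)%nat.
      apply Rle_trans with (c * (x ^ n) ^ 2 * (c * w (p + n)%nat ^ 2)); [right; ring |].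
      apply Rle_trans with (c * (x ^ n) ^ 2 * (w p ^ 2 * (w n * w (2 * p + n)%nat)));
        [| right; ring].
      apply Rmult_le_compat_l; [| exact Hw].
      apply Rmult_le_pos; [lra | apply pow2_ge_0].
    - apply (ex_series_scal_l (V := R_NormedModule)), tail_cvg.
    - apply tail_cvg.
    - apply (ex_series_scal_l (V := R_NormedModule)), tail_cvg. }
  rewrite !Series_scal_l in H.
  fold (tail_gf p) (tail_gf O) (tail_gf (2 * p)) in H.
  apply Rmult_le_reg_l with c; [exact Hc |]. nra.
Qed.

End RatioSequence.

(** * Coefficients of the incomplete beta series and their ratios *)

Definition beta_coef (c b : R) (k : nat) : R :=
  Gamma (c + b + INR k) / (Gamma b * Gamma (c + 1 + INR k)).

Definition beta_ratio (c b : R) (k : nat) : R :=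
  (c + b + INR k) / (c + 1 + INR k).

Lemma beta_coef_pos (c b : R) (k : nat) : -1 < c -> 1 < b -> 0 < beta_coef c b k.
Proof.
  intros Hc Hb. pose proof (pos_INR k).
  apply Rdiv_lt_0_compat; [| apply Rmult_lt_0_compat]; apply Gamma_pos; lra.
Qed.

Lemma beta_coef_succ (c b : R) (k : nat) :
  -1 < c -> 1 < b -> beta_coef c b (S k) = beta_ratio c b k * beta_coef c b k.
Proof.
  intros Hc Hb. pose proof (pos_INR k). unfold beta_coef, beta_ratio.
  rewrite S_INR, <- !Rplus_assoc, !Gamma_succ by lra.
  assert (0 < Gamma b) by (apply Gamma_pos; lra).
  assert (0 < Gamma (c + 1 + INR k)) by (apply Gamma_pos; lra).
  field. repeat split; lra.
Qed.

(** The ratio equals [1 + (b - 1) / (c + 1 + k)], and [b - 1] is positive. *)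
Lemma beta_ratio_antitone (c b : R) (i j : nat) :
  -1 < c -> 1 < b -> (i <= j)%nat -> beta_ratio c b j <= beta_ratio c b i.
Proof.
  intros Hc Hb Hij. apply le_INR in Hij. pose proof (pos_INR i). unfold beta_ratio.
  apply Rminus_le_0.
  replace ((c + b + INR i) / (c + 1 + INR i) - (c + b + INR j) / (c + 1 + INR j))
    with ((b - 1) * (INR j - INR i) / ((c + 1 + INR i) * (c + 1 + INR j)))
    by (field; lra).
  apply Rdiv_le_0_compat; [apply Rmult_le_pos | apply Rmult_lt_0_compat]; lra.
Qed.

Lemma beta_ratio_log_convex (c b : R) (p n : nat) :
  -1 < c -> 1 < b ->
  beta_ratio c b (p + n) ^ 2 <= beta_ratio c b n * beta_ratio c b (2 * p + n).
Proof.
  intros Hc Hb. pose proof (pos_INR n). pose proof (pos_INR p). unfold beta_ratio.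
  rewrite !plus_INR, mult_INR. simpl (INR 2).
  set (u := c + b + INR n). set (v := c + 1 + INR n). set (d := INR p) in *.
  assert (Hv : 0 < v) by (unfold v; lra).
  assert (Huv : v < u) by (unfold u, v; lra).
  replace (c + b + (d + INR n)) with (u + d) by (unfold u; ring).
  replace (c + 1 + (d + INR n)) with (v + d) by (unfold v; ring).
  replace (c + b + ((1 + 1) * d + INR n)) with (u + 2 * d) by (unfold u; ring).
  replace (c + 1 + ((1 + 1) * d + INR n)) with (v + 2 * d) by (unfold v; ring).
  apply Rminus_le_0.
  (* Since [u * (u + 2 * d) = (u + d) ^ 2 - d ^ 2], and likewise for [v], the numerator reduces to
     [d ^ 2 * ((u + d) ^ 2 - (v + d) ^ 2)]. *)
  replace (u / v * ((u + 2 * d) / (v + 2 * d)) - ((u + d) / (v + d)) ^ 2)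
    with (d ^ 2 * ((u - v) * (u + v + 2 * d)) / (v * (v + 2 * d) * (v + d) ^ 2))
    by (field; lra).
  apply Rdiv_le_0_compat.
  - apply Rmult_le_pos; [apply pow2_ge_0 | apply Rmult_le_pos; lra].
  - apply Rmult_lt_0_compat; [apply Rmult_lt_0_compat; lra | apply pow_lt; lra].
Qed.

(** The ratio recurrence iterated [n] times; it converts the Pochhammer quotients of [M] into
    quotients of coefficients. *)
Lemma beta_coef_pochhammer (c b : R) (k n : nat) :
  -1 < c -> 1 < b ->
  beta_coef c b (k + n) * pochhammer (c + 1 + INR k) n
  = beta_coef c b k * pochhammer (c + b + INR k) n.
Proof.
  intros Hc Hb. induction n as [| n IH].
  - rewrite Nat.add_0_r. reflexivity.
  - rewrite Nat.add_succ_r, beta_coef_succ by assumption. simpl pochhammer.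
    pose proof (pos_INR k). pose proof (pos_INR n).
    rewrite <- (Rmult_assoc (beta_coef c b k)), <- IH. unfold beta_ratio. rewrite plus_INR. field. lra.
Qed.

Lemma pochhammer_pos (p : R) (n : nat) : 0 < p -> 0 < pochhammer p n.
Proof.
  intros Hp. induction n as [| n IH]; simpl; [lra |].
  pose proof (pos_INR n). apply Rmult_lt_0_compat; lra.
Qed.

Lemma beta_ratio_cvg (c b : R) (k : nat) :
  -1 < c -> is_lim_seq (fun n => beta_ratio c b (k + n)) 1.
Proof.
  intros Hc.
  apply is_lim_seq_ext with (fun n => 1 + (b - 1) * / (c + 1 + INR k + INR n)).
  { intros n. pose proof (pos_INR k). pose proof (pos_INR n).
    unfold beta_ratio. rewrite plus_INR. field. lra. }
  replace (Finite 1) with (Finite (1 + (b - 1) * 0)) by (f_equal; ring).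
  apply is_lim_seq_plus'; [apply is_lim_seq_const |].
  apply is_lim_seq_mult'; [apply is_lim_seq_const |].
  apply (is_lim_seq_inv _ p_infty); [| discriminate].
  apply is_lim_seq_plus with (c + 1 + INR k) p_infty;
    [apply is_lim_seq_const | apply is_lim_seq_INR | reflexivity].
Qed.

(** Ratio test: the coefficient ratios tend to 1, so the term ratios tend to [x < 1]. *)
Lemma beta_tail_cvg (c b x : R) (k : nat) :
  -1 < c -> 1 < b -> 0 < x < 1 ->
  ex_series (fun n => beta_coef c b (k + n) * x ^ n).
Proof.
  intros Hc Hb Hx.
  assert (Hpos : forall n, 0 < beta_coef c b (k + n) * x ^ n).
  { intros n. apply Rmult_lt_0_compat; [now apply beta_coef_pos | now apply pow_lt]. }
  apply ex_series_ext with (fun n => Rabs (beta_coef c b (k + n) * x ^ n)).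
  { intros n. apply Rabs_pos_eq, Rlt_le, Hpos. }
  apply ex_series_DAlembert with x; [lra | intros n; apply Rgt_not_eq, Hpos |].
  apply is_lim_seq_ext with (fun n => beta_ratio c b (k + n) * x).
  - intros n. pose proof (beta_coef_pos c b (k + n) Hc Hb) as Hw.
    assert (Hxn : 0 < x ^ n) by now apply pow_lt.
    rewrite Rabs_pos_eq by (apply Rlt_le, Rdiv_lt_0_compat; apply Hpos).
    rewrite Nat.add_succ_r, beta_coef_succ by assumption. simpl (x ^ S n).
    field. split; apply Rgt_not_eq; assumption.
  - replace (Finite x) with (Finite (1 * x)) by (f_equal; ring).
    apply is_lim_seq_mult'; [now apply beta_ratio_cvg | apply is_lim_seq_const].
Qed.

(** Raising the first parameter by an integer only shifts the coefficient sequence, so all three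
    beta functions become tails of one series. *)
Lemma inc_beta_tail_gf (x c b : R) (j : nat) :
  inc_beta x (c + INR j) b
  = Rpower x (c + INR j) * Rpower (1 - x) b * tail_gf (beta_coef c b) x j.
Proof.
  unfold inc_beta, tail_gf. f_equal. apply Series_ext. intros n.
  unfold beta_coef. rewrite plus_INR.
  replace (c + INR j + b + INR n) with (c + b + (INR j + INR n)) by ring.
  replace (c + INR j + 1 + INR n) with (c + 1 + (INR j + INR n)) by ring.
  reflexivity.
Qed.

(** * Transfer of the tail bounds to the incomplete beta function *)

Theorem corollary3 (a b : R) (nu : nat)
  (hb : 1 < b) (hnu : (0 < nu)%nat) (ha : INR nu - 1 < a) :
  let m :=
    Gamma (a + b) ^ 2 / (Gamma b ^ 2 * Gamma (a + 1) ^ 2)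
    - Gamma (a + b - INR nu) * Gamma (a + b + INR nu)
      / (Gamma b ^ 2 * Gamma (a - INR nu + 1) * Gamma (a + INR nu + 1)) in
  let M :=
    (pochhammer (a + 1) nu * pochhammer (a + b - INR nu) nu
     - pochhammer (a + 1 - INR nu) nu * pochhammer (a + b) nu)
    / (pochhammer (a + 1) nu * pochhammer (a + b - INR nu) nu) in
  forall x : R, 0 < x < 1 ->
    m * Rpower x (2 * a) * Rpower (1 - x) (2 * b)
      <= inc_beta x a b ^ 2
         - inc_beta x (a - INR nu) b * inc_beta x (a + INR nu) b
      <= M * inc_beta x a b ^ 2.
Proof.
  intros m M x Hx.
  (* With the smallest parameter as base, [a - nu], [a] and [a + nu] sit at indices 0, [nu] and
     [2 * nu]. *)
  set (c := a - INR nu).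
  assert (Hc : -1 < c) by (unfold c; lra).
  assert (Ea : a = c + INR nu) by (unfold c; ring).
  assert (E2 : INR (2 * nu) = 2 * INR nu) by (rewrite mult_INR; simpl; ring).
  set (w := beta_coef c b).
  assert (Hm : m = w nu ^ 2 - w O * w (2 * nu)%nat).
  { unfold m, w, beta_coef. rewrite E2. simpl (INR 0).
    replace (a + b) with (c + b + INR nu) by (rewrite Ea; ring).
    replace (a + 1) with (c + 1 + INR nu) by (rewrite Ea; ring).
    replace (c + b + INR nu - INR nu) with (c + b + 0) by ring.
    replace (c + b + INR nu + INR nu) with (c + b + 2 * INR nu) by ring.
    replace (a - INR nu + 1) with (c + 1 + 0) by (unfold c; ring).
    replace (a + INR nu + 1) with (c + 1 + 2 * INR nu) by (unfold c; ring).
    pose proof (pos_INR nu).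
    assert (0 < Gamma b) by (apply Gamma_pos; lra).
    assert (0 < Gamma (c + 1 + 0)) by (apply Gamma_pos; lra).
    assert (0 < Gamma (c + 1 + INR nu)) by (apply Gamma_pos; lra).
    assert (0 < Gamma (c + 1 + 2 * INR nu)) by (apply Gamma_pos; lra).
    field. repeat split; lra. }
  assert (Hpos : forall k, 0 < w k) by (intros k; now apply beta_coef_pos).
  (* The quotient subtracted from 1 in [M] splits as [w O / w nu] (shift from index 0) times
     [w (2 * nu) / w nu] (shift from index [nu]). *)
  assert (HM : M = 1 - w O * w (2 * nu)%nat / w nu ^ 2).
  { pose proof (beta_coef_pochhammer c b 0 nu Hc hb) as H0.
    pose proof (beta_coef_pochhammer c b nu nu Hc hb) as H1.
    fold w in H0, H1. simpl (0 + nu)%nat in H0. simpl (INR 0) in H0.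
    replace (nu + nu)%nat with (2 * nu)%nat in H1 by lia.
    unfold M.
    replace (a + 1 - INR nu) with (c + 1 + 0) by (unfold c; ring).
    replace (a + b - INR nu) with (c + b + 0) by (unfold c; ring).
    replace (a + b) with (c + b + INR nu) by (rewrite Ea; ring).
    replace (a + 1) with (c + 1 + INR nu) by (rewrite Ea; ring).
    pose proof (pos_INR nu).
    assert (P0 : 0 < pochhammer (c + b + 0) nu) by (apply pochhammer_pos; lra).
    assert (P1 : 0 < pochhammer (c + 1 + INR nu) nu) by (apply pochhammer_pos; lra).
    pose proof (Hpos nu) as Wn. pose proof (Hpos O) as W0.
    replace (pochhammer (c + 1 + 0) nu)
      with (w O * pochhammer (c + b + 0) nu / w nu) by (rewrite <- H0; field; lra).
    replace (pochhammer (c + b + INR nu) nu)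
      with (w (2 * nu)%nat * pochhammer (c + 1 + INR nu) nu / w nu)
      by (rewrite H1; field; lra).
    field. repeat split; lra. }
  set (X := Rpower x a * Rpower (1 - x) b).
  assert (HX : 0 < X ^ 2)
    by (apply pow_lt, Rmult_lt_0_compat; apply exp_pos).
  assert (HXpow : Rpower x (2 * a) * Rpower (1 - x) (2 * b) = X ^ 2).
  { unfold X. replace (2 * a) with (a + a) by ring. replace (2 * b) with (b + b) by ring.
    rewrite !Rpower_plus. ring. }
  set (T := tail_gf w x).
  assert (Hmid : inc_beta x a b = X * T nu).
  { unfold X, T. rewrite Ea. apply inc_beta_tail_gf. }
  assert (Hprod : inc_beta x c b * inc_beta x (a + INR nu) b
                  = X ^ 2 * (T O * T (2 * nu)%nat)).
  { replace c with (c + INR 0) at 1 by (simpl; ring).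
    replace (a + INR nu) with (c + INR (2 * nu)) by (rewrite E2; unfold c; ring).
    rewrite !inc_beta_tail_gf. fold w T.
    (* The outer exponents sum to [2 * a], so the product carries the same prefactor [X ^ 2] as the
       square of the middle term. *)
    assert (Hpp : Rpower x (c + INR 0) * Rpower x (c + INR (2 * nu))
                  = Rpower x a * Rpower x a).
    { rewrite <- !Rpower_plus. f_equal. rewrite E2. unfold c. simpl. ring. }
    transitivity (Rpower x (c + INR 0) * Rpower x (c + INR (2 * nu))
      * Rpower (1 - x) b ^ 2 * (T O * T (2 * nu)%nat)); [ring |].
    rewrite Hpp. unfold X. ring. }
  assert (Hsucc : forall k, w (S k) = beta_ratio c b k * w k)
    by (intros k; now apply beta_coef_succ).
  assert (Hcvg : forall k, ex_series (fun n => w (k + n)%nat * x ^ n))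
    by (intros k; now apply beta_tail_cvg).
  rewrite Rmult_assoc, HXpow, Hprod, Hmid, Hm, HM, Rpow_mult_distr.
  split.
  - pose proof (tail_gf_lower w (beta_ratio c b) x Hpos Hsucc
      (fun i j => beta_ratio_antitone c b i j Hc hb) (proj1 Hx) Hcvg nu O) as H.
    rewrite !Nat.add_0_l in H. fold T in H.
    apply (Rmult_le_compat_l (X ^ 2)) in H; lra.
  - pose proof (tail_gf_upper w (beta_ratio c b) x Hpos Hsucc (proj1 Hx) Hcvg nu
      (fun n => beta_ratio_log_convex c b nu n Hc hb)) as H.
    fold T in H.
    assert (Hw : 0 < w nu ^ 2) by apply pow_lt, Hpos.
    assert (w O * w (2 * nu)%nat / w nu ^ 2 * T nu ^ 2 <= T O * T (2 * nu)%nat).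
    { replace (w O * w (2 * nu)%nat / w nu ^ 2 * T nu ^ 2)
        with (w O * w (2 * nu)%nat * T nu ^ 2 / w nu ^ 2)
        by (field; apply Rgt_not_eq, Hpos).
      apply Rle_div_l; [exact Hw |]. lra. }
    set (r := w O * w (2 * nu)%nat / w nu ^ 2) in *.
    apply (Rmult_le_compat_l (X ^ 2)) in H0; lra.
Qed.
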